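(* Let $G$ be a compact visibility graph. Then every edge of $G$ is either a bridge of $G$ or lies in a triangle ($K_3$) of $G$.
   Context: All graphs are finite and simple. Given a family of pairwise disjoint nonempty connected subsets (''regions'') of $\mathbb{R}^2$, a sightline is a closed line segment $\overline{ab}$ with $a\in A$, $b\in B$ for two different regions $A\neq B$ of the family, such that the segment intersects no region of the family other than $A$ and $B$. A graph $G$ is a visibility graph if there is a family of pairwise disjoint nonempty connected subsets of $\mathbb{R}^2$, one for each vertex of $G$, such that two distinct vertices are adjacent in $G$ if and only if there is a sightline between their regions. $G$ is a compact visibility graph if it has such a representation in which every region is compact (and connected). A bridge is an edge whose removal increases the number of connected components. *)

(* Defs.v *)
From HB Require Import structures.
From mathcomp Require Import all_boot all_order all_algebra.
From mathcomp Require Import all_classical all_reals all_analysis.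
Set Implicit Arguments. Unset Strict Implicit. Unset Printing Implicit Defensive.
Import Order.TTheory GRing.Theory Num.Theory numFieldNormedType.Exports.
Local Open Scope classical_set_scope.
Local Open Scope ring_scope.

(* The plane R^2 is modelled as R * R with the product topology. *)

Definition segment (R : realType) (a b : R * R) : set (R * R) :=
  [set p | exists2 t : R, 0 <= t <= 1 &
     p = (a.1 + t * (b.1 - a.1), a.2 + t * (b.2 - a.2))].

Definition sightline (R : realType) (V : finType) (reg : V -> set (R * R))
  (x y : V) (a b : R * R) : Prop :=
  [/\ x != y, reg x a, reg y b &
      forall z, z != x -> z != y -> segment a b `&` reg z = set0].

Definition compact_visibility_rep (R : realType) (V : finType) (e : rel V)
  (reg : V -> set (R * R)) : Prop :=
  [/\ forall v, reg v !=set0,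
      forall v, connected (reg v),
      forall v, compact (reg v),
      forall u v, u != v -> reg u `&` reg v = set0 &
      forall u v, u != v -> (e u v <-> exists a b, sightline reg u v a b)].

Definition compact_visibility_graph (R : realType) (V : finType) (e : rel V)
  : Prop := exists reg : V -> set (R * R), compact_visibility_rep e reg.

Definition remove_edge (V : finType) (e : rel V) (u v : V) : rel V :=
  fun x y => e x y && ~~ (((x == u) && (y == v)) || ((x == v) && (y == u))).

Definition ncomp (V : finType) (e : rel V) : nat := n_comp e predT.

Definition is_bridge (V : finType) (e : rel V) (u v : V) : Prop :=
  e u v /\ (ncomp e < ncomp (remove_edge e u v))%N.

(* Main.v *)
(* Color a strictly convex continuous function [f] on the plane by the region in
   which it attains its minimum over the union of all regions. If [f] attains
   this minimum in three regions at once, then strict convexity keeps [f] below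
   the minimum on the open segments joining the minimum points, so that these
   segments are sightlines: the three regions form a triangle. Hence, if the
   edge uv is in no triangle, the colors u, v and w never meet at one function.
   The strictly convex functions form a convex, hence simply connected, set, and
   a Sperner-type argument on fine grids shows that the number of changes
   between the colors u and v along a closed polygon of functions is even. A
   walk in the graph can be lifted to a polygon of functions: the functions |. -
   c|^2 with c in one region have the color of that region, and for a sightline
   cd the squared distances to c and d in a norm whose unit ellipse is very
   elongated along cd are joined by a segment on which only the colors of the
   two ends occur. A cycle through uv uses uv once, so this number would be odd;
   therefore uv is a bridge. *)
Require Import Defs.
From mathcomp Require Import all_boot all_order all_algebra.
From mathcomp Require Import all_classical all_reals all_analysis.
From mathcomp Require Import ring lra.
Import numFieldNormedType.Exports.
Set Implicit Arguments. Unset Strict Implicit. Unset Printing Implicit Defensive.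

(** * Connected components under deletion of edges *)

Section Components.
Variables (V : finType) (e e' : rel V).
Hypotheses (e_sym : symmetric e) (e'_sym : symmetric e').

(** Taking [e]-roots maps the [e']-roots onto the [e]-roots. This map is not injective: the
    [e']-roots of [u] and [v] differ but have the same image. *)
Lemma n_comp_lt_subrel (u v : V) :
  subrel e' e -> connect e u v -> ~~ connect e' u v ->
  (n_comp e predT < n_comp e' predT)%N.
Proof.
move=> sub cuv ncuv.
have ce := sym_connect_sym e_sym; have ce' := sym_connect_sym e'_sym.
have sub_c : subrel (connect e') (connect e).
  by apply: connect_sub => x y /sub; apply: connect1.
have rootK x : fingraph.root e (fingraph.root e' x) = fingraph.root e x.
  by apply/(fingraph.rootP ce); rewrite ce; apply: sub_c; apply: connect_root.
have rootsE (r : rel V) : n_comp r predT = #|[set x | roots r x]|.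
  by rewrite cardsE; apply: eq_card => x; rewrite !inE andbT.
rewrite !rootsE.
have -> : [set x | roots e x] = fingraph.root e @: [set x | roots e' x].
  apply/setP=> x; rewrite inE; apply/idP/imsetP => [/eqP rx | [y _ ->]].
    by exists (fingraph.root e' x); rewrite ?inE ?roots_root ?rootK.
  exact: roots_root.
rewrite ltn_neqAle leq_imset_card andbT; apply/negP => /imset_injP inj.
case/negP: ncuv; apply/(fingraph.rootP ce'); apply: inj.
- by rewrite inE roots_root.
- by rewrite inE roots_root.
- by rewrite !rootK; apply/(fingraph.rootP ce).
Qed.

End Components.

(** * Parity of color changes on a grid *)

Section Parity.

Lemma telescope_addb (b : nat -> bool) n :
  \big[addb/false]_(i < n) (b i (+) b i.+1) = b 0%N (+) b n.
Proof.
elim: n => [|n IHn]; first by rewrite big_ord0 addbb.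
by rewrite big_ord_recr/= IHn addbA addbK.
Qed.

(** [h] and [k] live on the grid edges in direction [j] and [i]. The hypothesis says that the
    boundary of each cell has sum zero mod 2. Summing over all cells cancels the interior edges and
    leaves the boundary of the square. *)
Lemma parity_grid (h k : nat -> nat -> bool) (N : nat) :
  (forall i j, (i < N)%N -> (j < N)%N ->
     h i j (+) h i.+1 j = k i j (+) k i j.+1) ->
  \big[addb/false]_(j < N) h N j =
  \big[addb/false]_(j < N) h 0%N j (+)
    (\big[addb/false]_(i < N) k i 0%N (+) \big[addb/false]_(i < N) k i N).
Proof.
move=> cell.
have strip i : (i < N)%N ->
    \big[addb/false]_(j < N) h i j (+) \big[addb/false]_(j < N) h i.+1 j =
    k i 0%N (+) k i N.
  move=> iN; rewrite -big_split/=.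
  by rewrite -telescope_addb; apply: eq_bigr => j _; apply: cell.
suff: forall n, (n <= N)%N -> \big[addb/false]_(j < N) h n j =
  \big[addb/false]_(j < N) h 0%N j (+)
    (\big[addb/false]_(i < n) k i 0%N (+) \big[addb/false]_(i < n) k i N).
  by apply.
elim=> [|n IHn] nN; first by rewrite !big_ord0 !addbF.
have := strip n nN; rewrite !big_ord_recr/= (IHn (ltnW nN)).
by do ![case: (\big[_/_]_(_ < _) _)]; case: (k n 0%N); case: (k n N).
Qed.

Variables (V : finType) (u v : V).

Definition switch (x y : V) := ((x == u) && (y == v)) || ((x == v) && (y == u)).

Lemma switchxx x : u != v -> switch x x = false.
Proof.
move=> uv; rewrite /switch; case: (eqVneq x u) => [->|_]; last by rewrite andbF.
by rewrite (negbTE uv).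
Qed.

Lemma switch_sym x y : switch x y = switch y x.
Proof. by rewrite /switch orbC [X in X || _]andbC [X in _ || X]andbC. Qed.

Lemma switch_uv x y : u != v ->
  (x == u) || (x == v) -> (y == u) || (y == v) ->
  switch x y = (x == u) (+) (y == u).
Proof.
move=> /negbTE uv; have vu : (v == u) = false by rewrite eq_sym.
by rewrite /switch => /orP[] /eqP-> /orP[] /eqP->; rewrite !eqxx ?uv ?vu.
Qed.

(** If all four corners have color [u] or [v], then [switch] is the difference of the indicator of
    [u] at the two ends, so it sums to zero around the cell. Otherwise a third color [w] occurs; the
    color missing from the cell is then [u] or [v], and no side is a switch. *)
Lemma switch_cell x y z t : u != v ->
  (forall w, w != u -> w != v ->
     exists k, k \in [:: u; v; w] /\ k \notin [:: x; y; z; t]) ->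
  switch x y (+) switch z t = switch x z (+) switch y t.
Proof.
move=> uv miss.
case: (boolP (all (pred2 u v) [:: x; y; z; t])) => [/and5P[/= xA yA zA tA _]|].
  rewrite !switch_uv//.
  by do ![case: (_ == _)].
case/allPn => w win /norP[wu wv].
have [k []] := miss w wu wv; rewrite !inE => /or3P[] /eqP->.
- rewrite !negb_or !(eq_sym u) /switch => /and4P[/negbTE-> /negbTE-> /negbTE-> /negbTE->].
  by rewrite !andbF.
- rewrite !negb_or !(eq_sym v) /switch => /and4P[/negbTE-> /negbTE-> /negbTE-> /negbTE->].
  by rewrite !andbF.
by move: win; rewrite !inE => ->.
Qed.

End Parity.

(** * Strictly convex functions and elliptic squared distances *)

Section StrictlyConvex.
Import Order.TTheory GRing.Theory Num.Theory.
Local Open Scope classical_set_scope.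
Local Open Scope ring_scope.
Variable R : realType.
Implicit Types (f g : R * R -> R) (a b c d p e : R * R).

Definition strictly_convex f := forall a b (t : R), a != b -> 0 < t < 1 ->
  f (a.1 + t * (b.1 - a.1), a.2 + t * (b.2 - a.2)) < f a + t * (f b - f a).

Definition lerp f g (t : R) : R * R -> R := fun p => f p + t * (g p - f p).

Lemma lerp0 f g : lerp f g 0 = f.
Proof. by apply/funext => p; rewrite /lerp mul0r addr0. Qed.

Lemma lerp1 f g : lerp f g 1 = g.
Proof. by apply/funext => p; rewrite /lerp mul1r addrC subrK. Qed.

Lemma lerpxx f t : lerp f f t = f.
Proof. by apply/funext => p; rewrite /lerp subrr mulr0 addr0. Qed.

Lemma continuous_lerp f g t :
  continuous f -> continuous g -> continuous (lerp f g t).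
Proof.
move=> cf cg p; apply: cvgD; first exact: cf.
by apply: cvgM; [exact: cvg_cst|apply: cvgB; [exact: cg|exact: cf]].
Qed.

Lemma strictly_convex_lerp f g t : 0 <= t <= 1 ->
  strictly_convex f -> strictly_convex g -> strictly_convex (lerp f g t).
Proof.
move=> /andP[t0 t1] cf cg a b s ab s01; rewrite /lerp.
have := cf a b s ab s01; have := cg a b s ab s01.
set x := f _; set y := g _; move=> hy hx.
(* For [t > 0] the strictness comes from [g] alone, which leaves a weak inequality for [f]; at
   [t = 0] it comes from [f]. *)
have [->|tn0] := eqVneq t 0; first lra.
have tp : 0 < t by rewrite lt_def tn0.
have : 0 < t * (g a + s * (g b - g a) - y) by rewrite mulr_gt0// subr_gt0.
have : 0 <= (1 - t) * (f a + s * (f b - f a) - x).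
  by rewrite mulr_ge0// subr_ge0// ltW.
nra.
Qed.

(* The squared norm of [p - c] for the inner product whose unit ellipse is
   stretched along [e] as [M] grows; [e = (1, 0)], [M = 1] is Euclidean. *)
Definition sqdist e (M : R) c p : R :=
  ((p.1 - c.1) * e.1 + (p.2 - c.2) * e.2) ^+ 2 +
  M * ((p.1 - c.1) * e.2 - (p.2 - c.2) * e.1) ^+ 2.

Lemma sqdistxx e M c : sqdist e M c c = 0.
Proof. by rewrite /sqdist; ring. Qed.

Lemma continuous_sqdist2 e M :
  continuous (fun z : (R * R) * (R * R) => sqdist e M z.1 z.2).
Proof.
have c11 : continuous (fun z : (R * R) * (R * R) => z.1.1).
  by move=> z; apply: (continuous_comp (f := fst) (g := fst)); exact: cvg_fst.
have c12 : continuous (fun z : (R * R) * (R * R) => z.1.2).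
  by move=> z; apply: (continuous_comp (f := fst) (g := snd));
    [exact: cvg_fst|exact: cvg_snd].
have c21 : continuous (fun z : (R * R) * (R * R) => z.2.1).
  by move=> z; apply: (continuous_comp (f := snd) (g := fst));
    [exact: cvg_snd|exact: cvg_fst].
have c22 : continuous (fun z : (R * R) * (R * R) => z.2.2).
  by move=> z; apply: (continuous_comp (f := snd) (g := snd)); exact: cvg_snd.
have cs (h : (R * R) * (R * R) -> R) : continuous h ->
    continuous (fun z => h z ^+ 2).
  move=> ch z; rewrite /continuous_at expr2.
  under eq_fun do rewrite expr2.
  by apply: cvgM; exact: ch.
move=> z; apply: cvgD; last apply: cvgM; [|exact: cvg_cst|];
  apply: cs => {}z; [apply: cvgD|apply: cvgB];
  apply: cvgM; try exact: cvg_cst; apply: cvgB; do [exact: c11|exact: c12|exact: c21|exact: c22].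
Qed.

Lemma cvg_sqdist e M (T : Type) (F : set_system T) (FF : Filter F)
    (h k : T -> R * R) c p :
  h @ F --> c -> k @ F --> p ->
  sqdist e M (h x) (k x) @[x --> F] --> sqdist e M c p.
Proof.
move=> hc kp; apply: (cvg_comp (G := nbhs (c, p)) (H := nbhs (sqdist e M c p))
  (fun x => (h x, k x)) (fun z : (R * R) * (R * R) => sqdist e M z.1 z.2)).
  exact: (cvg_pair hc kp).
exact: (@continuous_sqdist2 e M (c, p)).
Qed.

Lemma continuous_sqdist e M c : continuous (sqdist e M c).
Proof. by move=> p; apply: cvg_sqdist; [exact: cvg_cst|exact: cvg_id]. Qed.

Lemma sqdist_gt0 e M c p : e != 0 -> 0 < M -> c != p -> 0 < sqdist e M c p.
Proof.
move=> e0 M0 cp; rewrite /sqdist.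
set x := p.1 - c.1; set y := p.2 - c.2.
have xy : (x != 0) || (y != 0).
  rewrite !subr_eq0 -negb_and; apply: contra cp => /andP[/eqP h1 /eqP h2].
  by rewrite -pair_eqE/= h1 h2 !eqxx.
have ee : (e.1 != 0) || (e.2 != 0) by rewrite -negb_and.
have sq2 (z w : R) : (z != 0) || (w != 0) -> 0 < z ^+ 2 + w ^+ 2.
  case/orP => nz; first by rewrite ltr_wpDr ?sqr_ge0// lt_def sqrf_eq0 nz sqr_ge0.
  by rewrite ltr_wpDl ?sqr_ge0// lt_def sqrf_eq0 nz sqr_ge0.
(* Lagrange's identity settles the case [M = 1]; the two squares are then weighted separately. *)
have : 0 < (x * e.1 + y * e.2) ^+ 2 + (x * e.2 - y * e.1) ^+ 2.
  rewrite (_ : _ + _ = (x ^+ 2 + y ^+ 2) * (e.1 ^+ 2 + e.2 ^+ 2)); last by ring.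
  by rewrite mulr_gt0// sq2.
have [->|nz] := eqVneq (x * e.2 - y * e.1) 0; first by rewrite expr0n/= mulr0.
by move=> _; rewrite ltr_wpDl ?sqr_ge0// mulr_gt0// lt_def sqrf_eq0 nz sqr_ge0.
Qed.

(** For a quadratic form the convexity gap is exactly [t * (1 - t)] times the form at [b - a]. *)
Lemma strictly_convex_sqdist e M c : e != 0 -> 0 < M ->
  strictly_convex (sqdist e M c).
Proof.
move=> e0 M0 a b t ab /andP[t0 t1].
have := sqdist_gt0 e0 M0 ab.
have : 0 < t * (1 - t) by rewrite mulr_gt0// subr_gt0.
move=> tt ss; have := mulr_gt0 tt ss; rewrite -subr_gt0 => H.
rewrite -subr_gt0; apply: (lt_le_trans H); rewrite le_eqVlt; apply/orP; left.
by apply/eqP; rewrite /sqdist/=; ring.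
Qed.

End StrictlyConvex.

(** * Coloring functions by the region of their minimum *)

Section Coloring.
Import Order.TTheory GRing.Theory Num.Theory.
Local Open Scope classical_set_scope.
Local Open Scope ring_scope.
Variables (R : realType) (V : finType) (reg : V -> set (R * R)).
Hypothesis reg_neq0 : forall x, reg x !=set0.
Hypothesis reg_connected : forall x, connected (reg x).
Hypothesis reg_compact : forall x, compact (reg x).
Hypothesis reg_disjoint : forall x y, x != y -> reg x `&` reg y = set0.
Variables (u v : V).
Hypothesis uv : u != v.
Implicit Types (f g : R * R -> R) (a b c d p q e : R * R) (w : V).

Lemma reg_inj x y p : reg x p -> reg y p -> x = y.
Proof.
move=> xp yp; apply/eqP; apply: contraT => /reg_disjoint xy.
by suff: set0 p by []; rewrite -xy.
Qed.

(** Membership of [p] in a region is kept separate, so that the same bound can be compared with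
    points of any region. *)
Definition is_argmin f p := forall y q, reg y q -> f p <= f q.

(* The vertices play the role of colors: [f] gets the one whose region contains
   a minimum point of [f] on the union of all regions ([u] is a junk value). *)
Definition color f : V :=
  odflt u [pick x | `[< exists2 p, reg x p & is_argmin f p >]].

Lemma color_argmin f : continuous f ->
  exists2 p, reg (color f) p & is_argmin f p.
Proof.
move=> cf; rewrite /color; case: pickP => [x /asboolP//|/= none].
have minreg x : exists p, reg x p /\ forall q, reg x q -> f p <= f q.
  have [|p px pmin] := compact_EVT_min (reg_neq0 x) (@reg_compact x) (f := f).
    exact: continuous_subspaceT.
  exists p; split; first by rewrite inE in px.
  by move=> q qx; apply: pmin; rewrite inE.
have [m mP] := choice minreg.
case: (@Order.TotalTheory.arg_minP _ _ _ u xpredT (fun x => f (m x)) isT) => x _ xmin.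
have /asboolP[] := none x; exists (m x); first exact: (mP x).1.
by move=> y q yq; apply: le_trans (xmin y isT) _; apply: (mP y).2.
Qed.

Lemma color_neq f w : continuous f ->
  (forall q, reg w q -> exists x, exists2 p, reg x p & f p < f q) ->
  color f != w.
Proof.
move=> cf lt_w; have [q qc qmin] := color_argmin cf.
apply: contraTneq isT => cw; move: qc; rewrite cw => /lt_w[x [p xp]].
by rewrite ltNge (qmin x).
Qed.

Definition crossings f g (N : nat) : bool :=
  \big[addb/false]_(k < N) switch u v (color (lerp f g (k%:R / N%:R)))
                                      (color (lerp f g (k.+1%:R / N%:R))).

Lemma sightline_argmin f x y p a b :
  strictly_convex f -> x != y -> is_argmin f p ->
  reg x a -> reg y b -> f a <= f p -> f b <= f p ->
  sightline reg x y a b.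
Proof.
move=> cvx xy pmin xa yb ap bp; split=> // z zx zy.
apply/seteqP; split=> // q [[t /andP[t0 t1] qt]] zq /=.
have ab : a != b by apply: contra_neq xy => ab; apply: reg_inj xa _; rewrite ab.
(* Strict convexity says nothing at the two ends of the segment; there disjointness of the regions
   excludes [z]. *)
have [t00|tn0] := eqVneq t 0.
  by move: zx; rewrite (@reg_inj z x a) ?eqxx//; move: zq;
    rewrite qt t00 !mul0r !addr0; case: (a).
have [t11|tn1] := eqVneq t 1.
  by move: zy; rewrite (@reg_inj z y b) ?eqxx//; move: zq;
    rewrite qt t11 !mul1r ![_ + (_ - _)]addrC !subrK; case: (b).
have t01 : 0 < t < 1 by rewrite !lt_def tn0 t0 t1 eq_sym tn1.
have := cvx a b t ab t01; rewrite -qt; have := pmin z q zq.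
move: t01 => /andP[tp tl]; move: ap bp; nra.
Qed.

Hypothesis no_triangle : forall w, w != u -> w != v ->
  ~ ((exists a b, sightline reg u w a b) /\ (exists a b, sightline reg v w a b)).

(** If all three regions reached the minimum, [w] would see both [u] and [v]. The conclusion is a
    strict inequality on a compact region, not just a statement about [color f], because this form
    survives small perturbations of [f]. *)
Lemma missing_color f w p : strictly_convex f -> w != u -> w != v ->
  is_argmin f p ->
  exists2 k, k \in [:: u; v; w] & forall q, reg k q -> f p < f q.
Proof.
move=> cvx wu wv pmin; apply: contrapT => none.
have attained k : k \in [:: u; v; w] -> exists2 q, reg k q & f q <= f p.
  move=> kin; apply: contrapT => nq; apply: none; exists k => // q kq.
  by rewrite ltNge; apply/negP => qp; apply: nq; exists q.
have [a ua ap] := attained u (mem_head _ _).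
have [b vb bp] : exists2 q, reg v q & f q <= f p.
  by apply: attained; rewrite !inE eqxx orbT.
have [c wc cp] : exists2 q, reg w q & f q <= f p.
  by apply: attained; rewrite !inE eqxx !orbT.
apply: (no_triangle wu wv); split.
  by exists a, c; apply: sightline_argmin cvx _ pmin ua wc ap cp; rewrite eq_sym.
by exists b, c; apply: sightline_argmin cvx _ pmin vb wc bp cp; rewrite eq_sym.
Qed.

(** * Sperner argument on a triangle of functions *)

Section Triangle.
Variables f0 f1 f2 : R * R -> R.
Hypotheses (c0 : continuous f0) (c1 : continuous f1) (c2 : continuous f2).
Hypotheses (s0 : strictly_convex f0) (s1 : strictly_convex f1)
  (s2 : strictly_convex f2).

(** The square parametrizes the cone with apex [f0] over the segment from [f1] to [f2]; its side
    [x.1 = 0] collapses to [f0]. *)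
Let fan (x : R * R) := lerp f0 (lerp f1 f2 x.2) x.1.

Let square : set (R * R) := `[0, 1] `*` `[0, 1].

Let continuous_fan (x : R * R) : continuous (fan x).
Proof. by do 2 apply: continuous_lerp => //. Qed.

Let strictly_convex_fan (x : R * R) : square x -> strictly_convex (fan x).
Proof.
by move=> [/= + +]; rewrite !in_itv/= => ? ?; do 2 apply: strictly_convex_lerp => //.
Qed.

Let continuous_fan2 p :
  continuous (fun z : (R * R) * (R * R) => fan z.2 z.1 - fan z.2 p).
Proof.
have c21 : continuous (fun z : (R * R) * (R * R) => z.2.1).
  by move=> z; apply: (continuous_comp (f := snd) (g := fst));
    [exact: cvg_snd|exact: cvg_fst].
have c22 : continuous (fun z : (R * R) * (R * R) => z.2.2).
  by move=> z; apply: (continuous_comp (f := snd) (g := snd)); exact: cvg_snd.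
have cf (f : R * R -> R) : continuous f ->
    continuous (fun z : (R * R) * (R * R) => f z.1).
  by move=> cf z; apply: (continuous_comp (f := fst)); [exact: cvg_fst|exact: cf].
have cfan (h0 h1 h2 : (R * R) * (R * R) -> R) :
    continuous h0 -> continuous h1 -> continuous h2 ->
    continuous (fun z => h0 z + z.2.1 * (h1 z + z.2.2 * (h2 z - h1 z) - h0 z)).
  move=> ch0 ch1 ch2 z; apply: cvgD; first exact: ch0.
  apply: cvgM; first exact: c21.
  apply: cvgB; last exact: ch0.
  apply: cvgD; first exact: ch1.
  apply: cvgM; first exact: c22.
  by apply: cvgB; [exact: ch2|exact: ch1].
move=> z; apply: cvgB; apply: cfan; try exact: cf.
all: by move=> ?; exact: cvg_cst.
Qed.

Let locally_missing (x : R * R) w : w != u -> w != v -> square x ->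
  exists2 k, k \in [:: u; v; w] & \forall y \near x, color (fan y) != k.
Proof.
move=> wu wv sqx.
have [p cp pmin] := color_argmin (@continuous_fan x).
have [k kin klt] := missing_color (strictly_convex_fan sqx) wu wv pmin.
exists k => //.
(* The competitor [p] stays fixed while the function varies; compactness of the region of [k] gives
   one neighborhood of [x] for all its points [q]. *)
have lt_k : \forall y \near x, reg k `<=` [set q | fan y p < fan y q].
  apply: ((compact_near_coveringP _).1 (reg_compact (x := k)) _ (nbhs x)
    (fun y q => fan y p < fan y q)) => q kq.
  have : 0 < fan x q - fan x p by rewrite subr_gt0 klt.
  move=> /(cvgr_gt _ (@continuous_fan2 p (q, x))); apply: filterS => -[a b] /=.
  by rewrite subr_gt0.
near=> y; apply: color_neq; first exact: continuous_fan.
move=> q kq; exists (color (fan x)), p => //; move: q kq.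
by near: y; exact: lt_k.
Unshelve. all: by end_near.
Qed.

(** A Lebesgue number argument on the compact square. The radius is [2 / N] because balls are open
    and adjacent grid points are at distance [1 / N], so the ball at one corner contains the whole
    cell. *)
Let mesh : \forall N \near \oo, forall w, w != u -> w != v ->
  forall x, square x -> exists2 k, k \in [:: u; v; w] &
    forall y, ball x (2 / N%:R) y -> color (fan y) != k.
Proof.
apply: filter_forall => w.
have [->|wu] := eqVneq w u; first exact: nearW.
have [->|wv] := eqVneq w v; first exact: nearW.
suff : \forall N \near \oo, square `<=` [set x | exists2 k, k \in [:: u; v; w] &
    forall y, ball x (2 / N%:R) y -> color (fan y) != k].
  by apply: filterS => N + _ _ => sub x /sub.
have cs : compact square by apply: compact_setX; exact: segment_compact.
apply: ((compact_near_coveringP _).1 cs _ \oo (fun N x =>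
  exists2 k, k \in [:: u; v; w] &
    forall y, ball x (2 / N%:R) y -> color (fan y) != k)) => x sqx.
have [k kin /nbhs_ballP[r /= r0 rk]] := locally_missing wu wv sqx.
near=> x' N.
have N0 : (0 < N)%N by near: N; exact: nbhs_infty_gt.
have Nr : 2 / (r / 2) < N%:R by near: N; exact: nbhs_infty_gtr.
have xx' : ball x (r / 2) x' by near: x'; apply: nbhsx_ballx; lra.
exists k => // y x'y; apply: rk; apply: (ball_split xx'); apply: le_ball x'y.
rewrite ler_pdivrMr ?ltr0n// mulrC -ler_pdivrMr; last lra.
exact: ltW.
Unshelve. all: by end_near.
Qed.

(** Three sides of the grid run along the three sides of the triangle of functions. The fourth is
    constantly [f0] and has no switch. *)
Lemma crossings_triangle : \forall N \near \oo,
  crossings f1 f2 N = crossings f0 f1 N (+) crossings f0 f2 N.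
Proof.
near=> N.
have N0 : (0 < N)%N by near: N; exact: nbhs_infty_gt.
have meshN : forall w, w != u -> w != v ->
    forall x, square x -> exists2 k, k \in [:: u; v; w] &
      forall y, ball x (2 / N%:R) y -> color (fan y) != k.
  by near: N; exact: mesh.
pose pt i j : R * R := (i%:R / N%:R, j%:R / N%:R).
pose c i j := color (fan (pt i j)).
have NN : N%:R / N%:R = 1 :> R by rewrite divff// pnatr_eq0 -lt0n.
have fan1 j : c N j = color (lerp f1 f2 (j%:R / N%:R)).
  by rewrite /c /pt NN /fan lerp1.
have fan0 j : c 0%N j = color f0.
  by rewrite /c /pt mul0r /fan lerp0.
have fani0 i : c i 0%N = color (lerp f0 f1 (i%:R / N%:R)).
  by rewrite /c /pt /fan mul0r lerp0.
have faniN i : c i N = color (lerp f0 f2 (i%:R / N%:R)).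
  by rewrite /c /pt /fan NN lerp1.
have -> : crossings f1 f2 N =
    \big[addb/false]_(j < N) switch u v (c N j) (c N j.+1).
  by apply: eq_bigr => j _; rewrite !fan1.
have -> : crossings f0 f1 N =
    \big[addb/false]_(i < N) switch u v (c i 0%N) (c i.+1 0%N).
  by apply: eq_bigr => i _; rewrite !fani0.
have -> : crossings f0 f2 N =
    \big[addb/false]_(i < N) switch u v (c i N) (c i.+1 N).
  by apply: eq_bigr => i _; rewrite !faniN.
rewrite (@parity_grid (fun i j => switch u v (c i j) (c i j.+1))
  (fun i j => switch u v (c i j) (c i.+1 j))); last first.
  move=> i j iN jN.
  apply: switch_cell => // w wu wv.
  have sq : square (pt i j).
    by split; rewrite /= in_itv/= divr_ge0//= ler_pdivrMr ?ltr0n// mul1r ler_nat ltnW.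
  have [k kin kP] := meshN w wu wv _ sq.
  have near_pt i' j' : (i <= i' <= i.+1)%N -> (j <= j' <= j.+1)%N -> c i' j' != k.
    have step m m' : (m <= m' <= m.+1)%N -> ball (m%:R / N%:R : R) (2 / N%:R) (m'%:R / N%:R).
      move=> /andP[h1 h2]; rewrite /ball/= -mulrBl normrM [`|N%:R^-1|]ger0_norm//.
      rewrite ltr_pM2r ?invr_gt0 ?ltr0n// distrC ger0_norm ?subr_ge0 ?ler_nat//.
      by rewrite ltrBlDr -natrD ltr_nat (leq_ltn_trans h2).
    by move=> hi hj; apply: kP; split; apply: step.
  exists k; split => //; rewrite !inE !negb_or !(eq_sym k).
  by rewrite !near_pt ?leqnn ?leqnSn.
by rewrite [X in X (+) _]big1 ?addFb// => j _; rewrite !fan0 switchxx.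
Unshelve. all: by end_near.
Qed.

End Triangle.

(** * Equivalence of functions under even crossing parity *)

Definition same_side f g := \forall N \near \oo, crossings f g N = false.

Lemma same_side_refl f : same_side f f.
Proof.
by apply: nearW => N; apply: big1 => k _; rewrite !lerpxx switchxx.
Qed.

Definition regular f := continuous f /\ strictly_convex f.

Lemma regular_sqdist e M c : e != 0 -> 0 < M -> regular (sqdist e M c).
Proof.
by move=> e0 M0; split; [exact: continuous_sqdist|exact: strictly_convex_sqdist].
Qed.

(** Apply the parity relation to the degenerate triangle [f], [g], [f]. *)
Lemma same_side_sym f g : regular f -> regular g ->
  same_side f g -> same_side g f.
Proof.
move=> [cf sf] [cg sg] fg; near=> N.
rewrite (near (crossings_triangle cf cg cf sf sg sf) N)// (near fg N)//.
by rewrite (near (same_side_refl f) N).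
Unshelve. all: by end_near.
Qed.

Lemma same_side_trans f g h : regular f -> regular g -> regular h ->
  same_side f g -> same_side g h -> same_side f h.
Proof.
move=> rf rg [ch sh] /(same_side_sym rf rg) gf gh.
case: rf rg => [cf sf] [cg sg]; near=> N.
rewrite (near (crossings_triangle cg cf ch sg sf sh) N)//.
by rewrite (near gf N)// (near gh N).
Unshelve. all: by end_near.
Qed.

Let mesh_in01 N k : (k < N)%N -> 0 <= (k%:R / N%:R : R) <= 1 /\
  0 <= (k.+1%:R / N%:R : R) <= 1.
Proof.
move=> kN; have N0 : (0 < N)%N by case: N kN.
by rewrite !divr_ge0//= !ler_pdivrMr ?ltr0n// !mul1r !ler_nat kN ltnW.
Qed.

Lemma same_side_two_colors f g x y : ~~ switch u v x y ->
  (forall t, 0 <= t <= 1 ->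
     color (lerp f g t) = x \/ color (lerp f g t) = y) ->
  same_side f g.
Proof.
move=> nxy col; apply: nearW => N; apply: big1 => k _.
have [/col ck /col ck1] := mesh_in01 (ltn_ord k).
by case: ck => ->; case: ck1 => ->; apply/negbTE; rewrite ?switchxx// switch_sym.
Qed.

Lemma crossings_uv f g N :
  (forall t, 0 <= t <= 1 ->
     color (lerp f g t) = u \/ color (lerp f g t) = v) -> (0 < N)%N ->
  crossings f g N = (color f == u) (+) (color g == u).
Proof.
move=> col N0.
pose b k := color (lerp f g (k%:R / N%:R)) == u.
transitivity (b 0%N (+) b N).
  rewrite -telescope_addb; apply: eq_bigr => k _.
  have [/col ck /col ck1] := mesh_in01 (ltn_ord k).
  apply: switch_uv => //; first by case: ck => ->; rewrite eqxx ?orbT.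
  by case: ck1 => ->; rewrite eqxx ?orbT.
by rewrite /b mul0r lerp0 divff ?pnatr_eq0 -?lt0n// lerp1.
Qed.

(** * Changing the metric and moving the center within a region *)

Lemma color_sqdist e M x c : e != 0 -> 0 < M -> reg x c ->
  color (sqdist e M c) = x.
Proof.
move=> e0 M0 xc; have [p pc /(_ _ _ xc)] := color_argmin (@continuous_sqdist _ e M c).
rewrite sqdistxx; have [cp|cp] := eqVneq c p; first by move=> _; apply: (reg_inj pc); rewrite -cp.
by rewrite leNgt sqdist_gt0.
Qed.

(** Both functions vanish at [c] and are positive elsewhere, so every interpolant has its only
    minimum at [c] and keeps the color [x]. *)
Lemma same_side_metric e M e' M' x c :
  e != 0 -> 0 < M -> e' != 0 -> 0 < M' -> reg x c ->
  same_side (sqdist e M c) (sqdist e' M' c).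
Proof.
move=> e0 M0 e'0 M'0 xc.
apply: (@same_side_two_colors _ _ x x); first by rewrite switchxx.
move=> t /andP[t0 t1]; left; apply/eqP/negPn/negP => nx.
suff : color (lerp (sqdist e M c) (sqdist e' M' c) t) !=
  color (lerp (sqdist e M c) (sqdist e' M' c) t) by rewrite eqxx.
apply: color_neq; first by apply: continuous_lerp; exact: continuous_sqdist.
move=> q qc; exists x, c => //; rewrite /lerp !sqdistxx.
have cq : c != q by apply: contraNneq nx => cq; apply/eqP/(reg_inj qc); rewrite -cq.
have := sqdist_gt0 e0 M0 cq; have := sqdist_gt0 e'0 M'0 cq.
set A := sqdist _ _ _ _; set B := sqdist _ _ _ _; nra.
Qed.

Let eucl := sqdist ((1, 0) : R * R) 1.

Let eucl_neq0 : ((1, 0) : R * R) != 0.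
Proof. by rewrite -pair_eqE/= oner_eq0. Qed.

(** The other regions are compact and avoid [c]. Hence for [c'] close to [c] the point [c] beats all
    their points for every function between [eucl c] and [eucl c'], and only the color [x]
    occurs. *)
Let same_side_near x c : reg x c ->
  \forall c' \near c, reg x c' -> same_side (eucl c) (eucl c').
Proof.
move=> xc.
have near_far : \forall c' \near c, forall y, y != x -> forall q, reg y q ->
    eucl c' c < eucl c q /\ eucl c' c < eucl c' q.
  apply: (@filter_forall _ V (fun y c' => y != x -> forall q, reg y q ->
    eucl c' c < eucl c q /\ eucl c' c < eucl c' q) (nbhs c)) => y.
  have [->|yx] := eqVneq y x; first exact: nearW.
  suff : \forall c' \near c, reg y `<=` [set q | eucl c' c < eucl c q /\ eucl c' c < eucl c' q].
    by apply: filterS => c' + _ => sub q /sub.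
  apply: ((compact_near_coveringP _).1 (reg_compact (x := y)) _ (nbhs c)
    (fun c' q => eucl c' c < eucl c q /\ eucl c' c < eucl c' q)) => q yq.
  have cq : 0 < eucl c q.
    apply: sqdist_gt0 => //; apply: contra_neq yx => cq; apply: (reg_inj yq).
    by rewrite -cq.
  have d0 : (eucl z.2 c) @[z --> (q, c)] --> (0 : R).
    by rewrite -(sqdistxx (1, 0) 1 c); apply: cvg_sqdist; [exact: cvg_snd|exact: cvg_cst].
  have d1 : (eucl c z.1) @[z --> (q, c)] --> eucl c q.
    by apply: cvg_sqdist; [exact: cvg_cst|exact: cvg_fst].
  have d2 : (eucl z.2 z.1) @[z --> (q, c)] --> eucl c q.
    by apply: cvg_sqdist; [exact: cvg_snd|exact: cvg_fst].
  have e1 : (eucl c z.1 - eucl z.2 c) @[z --> (q, c)] --> eucl c q - 0.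
    by apply: cvgB.
  have e2 : (eucl z.2 z.1 - eucl z.2 c) @[z --> (q, c)] --> eucl c q - 0.
    by apply: cvgB.
  rewrite subr0 in e1 e2.
  have h1 : \forall z \near (q, c), 0 < eucl c z.1 - eucl z.2 c.
    exact: (cvgr_gt _ e1 _ cq).
  have h2 : \forall z \near (q, c), 0 < eucl z.2 z.1 - eucl z.2 c.
    exact: (cvgr_gt _ e2 _ cq).
  apply: filterS2 h1 h2 => -[a b]/=.
  by rewrite !subr_gt0.
near=> c' => xc'.
have far : forall y, y != x -> forall q, reg y q ->
    eucl c' c < eucl c q /\ eucl c' c < eucl c' q.
  by near: c'; exact: near_far.
apply: (@same_side_two_colors _ _ x x); first by rewrite switchxx.
move=> t /andP[t0 t1]; left; apply/eqP/negPn/negP => nx.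
suff : color (lerp (eucl c) (eucl c') t) != color (lerp (eucl c) (eucl c') t).
  by rewrite eqxx.
apply: color_neq; first by apply: continuous_lerp; exact: continuous_sqdist.
move=> q qc; exists x, c => //; rewrite /lerp.
rewrite (_ : eucl c c = 0); last exact: sqdistxx.
have [] := far _ nx q qc.
have B0 : 0 <= eucl c' c by rewrite /eucl /sqdist mul1r addr_ge0 ?sqr_ge0.
move: B0; move: (eucl c q) (eucl c' c) (eucl c' q) => A B C B0 AB CB.
have [->|tn0] := eqVneq t 0; first lra.
have tp : 0 < t by rewrite lt_def tn0.
have : 0 < t * (C - B) by rewrite mulr_gt0// subr_gt0.
have : 0 <= (1 - t) * (A - B) by rewrite mulr_ge0// subr_ge0// ltW.
have : 0 <= (1 - t) * B by rewrite mulr_ge0// subr_ge0.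
lra.
Unshelve. all: by end_near.
Qed.

(** * Colors along a sightline *)

Lemma sightline_neq x y c d : sightline reg x y c d ->
  (d.1 - c.1, d.2 - c.2) != 0.
Proof.
move=> [xy xc yd _]; apply: contra_neq xy => -[/eqP + /eqP].
rewrite !subr_eq0 => /eqP h1 /eqP h2; apply: reg_inj xc _; suff -> : c = d by [].
by apply/eqP; rewrite -pair_eqE/= h1 h2 !eqxx.
Qed.

(* The class of [eucl c] modulo [same_side] is locally constant on a region. *)
Let same_side_region x c d : reg x c -> reg x d -> same_side (eucl c) (eucl d).
Proof.
move=> xc xd.
have re p : regular (eucl p) by exact: regular_sqdist.
pose B := reg x `&` [set p | same_side (eucl c) (eucl p)].
suff BE : B = reg x by move: xd; rewrite -BE => -[].
(* Written as implications, [S] and [D] hold vacuously off the region. Their interiors are therefore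
   open sets of the plane that cut the region in [B] and in its complement. *)
pose S := [set p | reg x p -> same_side (eucl c) (eucl p)].
pose D := [set p | reg x p -> ~ same_side (eucl c) (eucl p)].
have nearS p : reg x p -> same_side (eucl c) (eucl p) -> S° p.
  move=> xp cp; apply: filterS (same_side_near xp) => q pq xq.
  exact: same_side_trans cp (pq xq).
have nearD p : reg x p -> ~ same_side (eucl c) (eucl p) -> D° p.
  move=> xp cp; apply: filterS (same_side_near xp) => q pq xq cq.
  by apply: cp; apply: same_side_trans cq (same_side_sym _ _ (pq xq)).
apply: reg_connected.
- by exists c; split => //; exact: same_side_refl.
- exists S°; first exact: open_interior.
  apply/seteqP; split=> p [xp cp]; split => //; first exact: nearS.
  exact: (interior_subset cp).
- exists (~` D°); first by apply: open_closedC; exact: open_interior.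
  apply/seteqP; split=> p [xp cp]; split => //.
    by move=> /interior_subset /(_ xp).
  by apply: contrapT => ncp; apply: cp; exact: nearD.
Qed.

(* A thin enough ellipse along a sightline sees nothing beside it. *)
Let sightline_colors x y c d : sightline reg x y c d -> exists2 M, 0 < M &
  forall t, 0 <= t <= 1 ->
    let e := (d.1 - c.1, d.2 - c.2) in
    color (lerp (sqdist e M c) (sqdist e M d) t) = x \/
    color (lerp (sqdist e M c) (sqdist e M d) t) = y.
Proof.
move=> s; have [xy xc yd seg] := s.
pose e := (d.1 - c.1, d.2 - c.2).
pose L := e.1 ^+ 2 + e.2 ^+ 2.
pose along p := (p.1 - c.1) * e.1 + (p.2 - c.2) * e.2.
pose across p := (p.1 - c.1) * e.2 - (p.2 - c.2) * e.1.
(* In the scaled orthogonal coordinates [along] and [across], [c] is the origin and [d] is [(L, 0)].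
   A far point lies behind [c], beyond [d], or so far to the side that its value exceeds [L ^+ 2],
   which bounds the values at [c] and [d]. *)
pose far M p := [\/ along p < 0, L < along p | L ^+ 2 < M * across p ^+ 2].
have thin : \forall M \near +oo, forall z, z != x -> z != y ->
    forall q, reg z q -> far M q.
  apply: (@filter_forall _ V (fun z M => z != x -> z != y ->
    forall q, reg z q -> far M q) (pinfty_nbhs R)) => z.
  have [->|zx] := eqVneq z x; first exact: nearW.
  have [->|zy] := eqVneq z y; first exact: nearW.
  suff : \forall M \near +oo, reg z `<=` [set q | far M q].
    by apply: filterS => M + _ _ => sub q /sub.
  apply: ((compact_near_coveringP _).1 (reg_compact (x := z)) _ (pinfty_nbhs R) far).
  move=> q zq.
  have c_along : along p @[p --> q] --> along q.
    by apply: cvgD; apply: cvgM; try exact: cvg_cst; apply: cvgB;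
      do [exact: cvg_cst|exact: cvg_fst|exact: cvg_snd].
  have c_across : across p @[p --> q] --> across q.
    by apply: cvgB; apply: cvgM; try exact: cvg_cst; apply: cvgB;
      do [exact: cvg_cst|exact: cvg_fst|exact: cvg_snd].
  have [aq0|aq0] := eqVneq (across q) 0; last first.
    have k0 : 0 < across q ^+ 2 by rewrite lt_def sqrf_eq0 aq0 sqr_ge0.
    have c_sq : across p ^+ 2 @[p --> q] --> across q ^+ 2.
      by rewrite expr2; under eq_fun do rewrite expr2; apply: cvgM.
    near=> p M; apply: Or33.
    (* Halving leaves a positive lower bound valid near [q], hence one threshold for [M] there. *)
    have h1 : across q ^+ 2 / 2 < across p ^+ 2.
      by near: p; apply: (cvgr_gt _ c_sq); lra.
    have h2 : L ^+ 2 / (across q ^+ 2 / 2) < M.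
      by near: M; apply: nbhs_pinfty_gt; exact: num_real.
    have M0 : 0 < M by apply: le_lt_trans h2; rewrite divr_ge0 ?sqr_ge0//; lra.
    rewrite ltr_pdivrMr in h2; last lra.
    by apply: (lt_trans h2); rewrite ltr_pM2l.
  have [neg|nneg] := ltP (along q) 0.
    near=> p M; have pneg : along p < 0 by near: p; exact: (cvgr_lt _ c_along).
    exact: Or31.
  have [big|nbig] := ltP L (along q).
    near=> p M; have pbig : L < along p by near: p; exact: (cvgr_gt _ c_along).
    exact: Or32.
  (* The remaining [q] has [across q = 0] and [along q] between [0] and [L]: it lies on the
     sightline, which misses [reg z]. *)
  exfalso; have : (segment c d `&` reg z) q; last by rewrite seg.
  split => //.
  have L0 : L != 0.
    by rewrite paddr_eq0 ?sqr_ge0// !sqrf_eq0; exact: (sightline_neq s).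
  exists (along q / L).
    have Lp : 0 < L by rewrite lt_def L0 addr_ge0 ?sqr_ge0.
    by rewrite divr_ge0 ?(ltW Lp)//= ler_pdivrMr// mul1r.
  have key1 : along q * e.1 - L * (q.1 - c.1) = - across q * e.2.
    by rewrite /along /L /across; ring.
  have key2 : along q * e.2 - L * (q.2 - c.2) = across q * e.1.
    by rewrite /along /L /across; ring.
  have fill (m r : R) : along q * m - L * r = 0 -> along q / L * m = r.
    move=> /eqP; rewrite subr_eq0 => /eqP h.
    by rewrite mulrAC h mulrAC divff// mul1r.
  move: key1 key2; rewrite aq0 oppr0 !mul0r => /fill /= -> /fill /= ->.
  by rewrite ![_ + (_ - _)]addrC !subrK; case: (q).
have [M [M0 farM]] : exists M, 0 < M /\
    forall z, z != x -> z != y -> forall q, reg z q -> far M q.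
  near (pinfty_nbhs R) => M; exists M; split; near: M; last exact: thin.
  by apply: nbhs_pinfty_gt; exact: num_real.
exists M => // t /andP[t0 t1] /=.
pose f := lerp (sqdist e M c) (sqdist e M d) t; rewrite -/e -/f.
have cf : continuous f by apply: continuous_lerp; exact: continuous_sqdist.
apply: contrapT => /not_orP[/eqP nx /eqP ny].
suff : color f != color f by rewrite eqxx.
apply: color_neq => // q /(farM _ nx ny) far_q.
have fE p : f p = (1 - t) * along p ^+ 2 + t * (along p - L) ^+ 2 + M * across p ^+ 2.
  by rewrite /f /lerp /sqdist /along /across /L /e /=; ring.
have fc : f c = t * L ^+ 2.
  by rewrite fE /along /across !subrr !mul0r; ring.
have fd : f d = (1 - t) * L ^+ 2.
  by rewrite fE /along /across /L /e /=; ring.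
have L0 : 0 <= L by rewrite addr_ge0 ?sqr_ge0.
have A0 : 0 <= M * across q ^+ 2 by rewrite mulr_ge0 ?sqr_ge0 ?ltW.
(* Points behind [c] or off to the side lose to [c], points beyond [d] lose to [d]. *)
case: far_q => [neg|big|off].
- exists x, c => //; rewrite fc fE.
  have : 0 < along q ^+ 2 by rewrite lt_def sqrf_eq0 lt_eqF//= sqr_ge0.
  have : 0 <= t * (- along q * L) by rewrite mulr_ge0// mulr_ge0// oppr_ge0 ltW.
  nra.
- exists y, d => //; rewrite fd fE.
  have : 0 < (along q - L) ^+ 2 by rewrite exprn_gt0// subr_gt0.
  have : 0 <= (1 - t) * ((along q - L) * L).
    by rewrite mulr_ge0 ?subr_ge0// mulr_ge0// subr_ge0 ltW.
  nra.
- exists x, c => //; rewrite fc fE.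
  have : 0 <= (1 - t) * along q ^+ 2 by rewrite mulr_ge0 ?sqr_ge0 ?subr_ge0.
  have : 0 <= t * (along q - L) ^+ 2 by rewrite mulr_ge0 ?sqr_ge0.
  have : 0 <= (1 - t) * L ^+ 2 by rewrite mulr_ge0 ?sqr_ge0 ?subr_ge0.
  nra.
Unshelve. all: by end_near.
Qed.

(** Pass at [c] to the thin ellipse, slide its center to [d], and return to the Euclidean metric
    there. *)
Let same_side_sightline x y c d : sightline reg x y c d -> ~~ switch u v x y ->
  same_side (eucl c) (eucl d).
Proof.
move=> s nuv; have [M M0 /= col] := sightline_colors s.
have [xy xc yd _] := s; have e0 := sightline_neq s.
have m01 : 0 < 1 :> R by [].
apply: (same_side_trans _ _ _ (same_side_metric eucl_neq0 m01 e0 M0 xc));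
  try exact: regular_sqdist.
apply: (same_side_trans _ _ _ (same_side_two_colors nuv col));
  try exact: regular_sqdist.
exact: (same_side_metric e0 M0 eucl_neq0 m01 yd).
Qed.

(** In the thin metric only the colors [u] and [v] occur, with [u] at one end and [v] at the other,
    so the number of switches is odd. *)
Let sightline_uv_crosses a b : sightline reg u v a b ->
  ~ same_side (eucl a) (eucl b).
Proof.
move=> s ab; have [M M0 /= col] := sightline_colors s.
have [_ ua vb _] := s; have e0 := sightline_neq s.
have m01 : 0 < 1 :> R by [].
pose e := (b.1 - a.1, b.2 - a.2).
have : same_side (sqdist e M a) (sqdist e M b).
  apply: (same_side_trans _ _ _ (same_side_metric e0 M0 eucl_neq0 m01 ua));
    try exact: regular_sqdist.
  apply: (same_side_trans _ _ _ ab); try exact: regular_sqdist.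
  exact: (same_side_metric eucl_neq0 m01 e0 M0 vb).
move=> side; near \oo => N.
have N0 : (0 < N)%N by near: N; exact: nbhs_infty_gt.
have : crossings (sqdist e M a) (sqdist e M b) N = false by near: N.
rewrite (crossings_uv col N0).
by rewrite (color_sqdist e0 M0 ua) (color_sqdist e0 M0 vb) eqxx eq_sym (negbTE uv).
Unshelve. all: by end_near.
Qed.

(** * Lifting walks of the graph to polygons of functions *)

Lemma uv_separates (e' : rel V) :
  (forall x y, e' x y -> exists a b, sightline reg x y a b) ->
  (forall x y, e' x y -> ~~ switch u v x y) ->
  (exists a b, sightline reg u v a b) -> ~~ connect e' u v.
Proof.
move=> e's e'uv [a [b sab]]; apply/negP => /connectP[p].
have [_ ua vb _] := sab; move=> up lv; apply: (sightline_uv_crosses sab).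
(* The end points [c] and [d] are arbitrary in their regions, since a sightline may leave a region
   at another point than the one where the previous sightline arrived. *)
suff walk : forall (p : seq V) x, path e' x p -> forall c d, reg x c -> reg (last x p) d ->
    same_side (eucl c) (eucl d) by apply: (walk p u) => //; rewrite -lv.
elim=> [|y {up lv}p IHp] x /=; first by move=> _; exact: same_side_region.
move=> /andP[xy yp] c d xc ld.
have [a' [b' s']] := e's _ _ xy; have [_ xa' yb' _] := s'.
have re q : regular (eucl q) by exact: regular_sqdist.
apply: (same_side_trans _ _ _ (same_side_region xc xa')) => //.
apply: (same_side_trans _ _ _ (same_side_sightline s' (e'uv _ _ xy))) => //.
exact: IHp yp _ _ yb' ld.
Qed.

End Coloring.

Theorem theorem2 (R : realType) (V : finType) (e : rel V)
  (e_sym : symmetric e) (e_irr : irreflexive e)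
  (hG : compact_visibility_graph R e) :
  forall u v : V, e u v -> is_bridge e u v \/ exists w : V, e u w /\ e v w.
Proof.
case: hG => reg [ne conn comp disj rep] u v uv.
have [|no_w] := pselect (exists w, e u w /\ e v w); first by right.
left; split => //.
have e_neq x y : e x y -> x != y.
  by move=> xy; apply: contraTneq xy => ->; rewrite e_irr.
apply: (@n_comp_lt_subrel _ _ _ _ _ u v) => //.
- by move=> x y; rewrite /remove_edge e_sym orbC [(y == u) && _]andbC [(y == v) && _]andbC.
- by move=> x y /andP[].
- exact: connect1.
apply: (uv_separates ne conn comp disj (e_neq _ _ uv)).
- move=> w wu wv [suw svw]; apply: no_w; exists w.
  by split; apply/rep => //; rewrite eq_sym.
- by move=> x y /andP[xy _]; apply/rep => //; exact: e_neq.
- by move=> x y /andP[].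
- by apply/rep => //; exact: e_neq.
Qed.
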